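(* Let $p,n\in\mathbb N$ with $p\ge n\ge 10$, and write $p=k(n-1)+r$ with $k\in\mathbb N$ and $r\in\{0,1,\ldots,n-2\}$. Then $$\mathrm{ex}(p;T_n''')=\frac{(n-2)p-r(n-1-r)}2+\max\Big\{0,\Big\lfloor\frac{r(n-4-r)-3(n-1)}2\Big\rfloor\Big\}.$$
   Context: All graphs are finite simple graphs. For a graph $L$, $\mathrm{ex}(p;L)$ denotes the maximum number of edges in a graph on $p$ vertices that contains no subgraph isomorphic to $L$. For $n\ge 6$, $T_n'''$ is the tree on vertex set $\{v_0,\ldots,v_{n-1}\}$ with edge set $\{v_0v_1,v_0v_2,\ldots,v_0v_{n-4},\ v_1v_{n-3},\ v_2v_{n-2},\ v_3v_{n-1}\}$. $\lfloor x\rfloor$ is the greatest integer not exceeding $x$; $\mathbb N=\{1,2,\ldots\}$. *)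

(* Defs.v *)
From HB Require Import structures.
From mathcomp Require Import all_boot all_order all_algebra.
Set Implicit Arguments. Unset Strict Implicit. Unset Printing Implicit Defensive.
Import Order.TTheory GRing.Theory Num.Theory.

Definition simple_graph (p : nat) (E : {set {set 'I_p}}) : bool :=
  [forall e in E, #|e| == 2].

Definition contains_sub (p m : nat) (E : {set {set 'I_p}}) (L : rel 'I_m) : bool :=
  [exists f : {ffun 'I_m -> 'I_p},
     injectiveb f &&
     [forall u : 'I_m, forall v : 'I_m, L u v ==> ([set f u; f v] \in E)]].

Definition ex (p m : nat) (L : rel 'I_m) : nat :=
  \max_(E : {set {set 'I_p}} | simple_graph E && ~~ contains_sub E L) #|E|.

Definition T3_dir (n : nat) (i j : 'I_n) : bool :=
  [|| (i == 0 :> nat) && (1 <= j <= n - 4),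
      (i == 1 :> nat) && (j == n - 3 :> nat),
      (i == 2 :> nat) && (j == n - 2 :> nat)
    | (i == 3 :> nat) && (j == n - 1 :> nat)].

Definition T3 (n : nat) : rel 'I_n := fun i j => T3_dir i j || T3_dir j i.

(* Main.v *)
Require Import Defs.
From HB Require Import structures.
From mathcomp Require Import all_boot all_order all_algebra.
From mathcomp Require Import zify.
Import Order.TTheory GRing.Theory Num.Theory.
Set Implicit Arguments. Unset Strict Implicit. Unset Printing Implicit Defensive.

(** The lower bound comes from disjoint unions of copies of [K_(n-1)] with either
    a [K_r] or a graph on [n - 1 + r] vertices that is as close to
    [(n-5)]-regular as parity allows.

    For the upper bound one removes a set of vertices meeting few edges and
    inducts, the claimed value being superadditive enough.  Let [v] have maximal
    degree [D], with neighbourhood [N] and non-neighbours [W].  If [D <= n - 5]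
    the degree sum suffices.  Otherwise [T_n'''] centred at [v] amounts to a
    3-matching off [v] whose edges all meet [N], at most [D - (n - 4)] of them
    lying inside [N].  So:
    - if [D >= n - 1], the edges meeting [N] have no 3-matching, hence there are
      at most [2 D] of them, and [v |: N] is removed;
    - if [D = n - 2], either no edge leaves [v |: N], or deleting the ends of one
      that does leaves no 2-matching among the edges meeting [N];
    - if [D = n - 3], either one vertex covers all [N]-[W] edges, or an [N]-[W]
      2-matching meets every edge touching [N];
    - if [D = n - 4], two vertices cover all [N]-[W] edges by Konig's theorem;
      one removes [v |: N] together with the covering vertices in [W].  Only when
      both covering vertices lie in [N] does one edge too many get removed; it is
      absorbed because the bound is strictly superadditive there, or, when
      [n - 1] divides [#|W|], because [G[W]] has maximal degree [n - 4]. *)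

(** * Counting ordered adjacent pairs, and matchings *)

Section Counting.
Variable T : finType.
Implicit Types (h : rel T) (A B C Q R U : {set T}) (x y : T).

(* Ordered pairs: [cnt h A A] is twice the number of edges inside [A]. *)
Definition cnt h A B : nat := \sum_(x in A) \sum_(y in B) h x y.

Lemma cnt1 h x B : cnt h [set x] B = #|[set y in B | h x y]|.
Proof.
rewrite /cnt big_set1 -sum1_card big_mkcond [RHS]big_mkcond /=.
by apply: eq_bigr => y _; rewrite inE; case: (y \in B); case: (h x y).
Qed.

Lemma cntE h A B : cnt h A B = \sum_(x in A) cnt h [set x] B.
Proof. by apply: eq_bigr => x _; rewrite /cnt big_set1. Qed.

Lemma cntC h A B : symmetric h -> cnt h A B = cnt h B A.
Proof.
move=> hC; rewrite /cnt exchange_big /=.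
by apply: eq_bigr => x _; apply: eq_bigr => y _; rewrite hC.
Qed.

Lemma sum_subset (F : T -> nat) A B : A \subset B ->
  \sum_(x in A) F x <= \sum_(x in B) F x.
Proof. by move=> sAB; rewrite [leqRHS](big_setID A) /= (setIidPr sAB) leq_addr. Qed.

Lemma sum_setU (F : T -> nat) A B :
  \sum_(x in A :|: B) F x <= \sum_(x in A) F x + \sum_(x in B) F x.
Proof.
rewrite (big_setID A) /= (setIidPr (subsetUl _ _)) leq_add2l.
by apply: sum_subset; rewrite setDUl setDv set0U subsetDl.
Qed.

Lemma cntS h A A' B B' : A \subset A' -> B \subset B' -> cnt h A B <= cnt h A' B'.
Proof.
move=> sA sB; apply: leq_trans (sum_subset _ sA).
by apply: leq_sum => x _; apply: sum_subset.
Qed.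

Lemma cntUl h A A' B : cnt h (A :|: A') B <= cnt h A B + cnt h A' B.
Proof. exact: sum_setU. Qed.

Lemma cntUr h A B B' : cnt h A (B :|: B') <= cnt h A B + cnt h A B'.
Proof.
by rewrite /cnt -big_split; apply: leq_sum => x _; apply: sum_setU.
Qed.

Lemma cnt_eq0 h A B : (forall x y, x \in A -> y \in B -> ~~ h x y) -> cnt h A B = 0.
Proof.
move=> h0; apply: big1 => x xA; apply: big1 => y yB.
by rewrite (negbTE (h0 x y xA yB)).
Qed.

Lemma cnt_leM h A B d : (forall x, x \in A -> cnt h [set x] B <= d) ->
  cnt h A B <= #|A| * d.
Proof. by move=> hd; rewrite cntE -sum_nat_const; apply: leq_sum. Qed.

Lemma cnt1_le h x B : cnt h [set x] B <= #|B|.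
Proof. by rewrite cnt1 subset_leq_card //; apply/subsetP => y; rewrite inE => /andP[]. Qed.

Lemma cnt1_leD1 h x B : irreflexive h -> cnt h [set x] B <= #|B :\ x|.
Proof.
move=> h0; rewrite cnt1 subset_leq_card //; apply/subsetP => y.
by rewrite !inE => /andP[-> hxy]; rewrite andbT; apply: contraTneq hxy => ->; rewrite h0.
Qed.

Lemma cnt_complete h A : irreflexive h -> cnt h A A <= #|A| * #|A|.-1.
Proof.
move=> h0; apply: cnt_leM => x xA; apply: leq_trans (cnt1_leD1 _ _ h0) _.
by rewrite (cardsD1 x A) xA.
Qed.

(** Deleting [C] costs at most the pairs with an end in [C], counted in both orders; the rest splits
    along [R] and [Q]. In the applications few or no edges join [R] to [Q]. *)
Lemma cnt_cut h U C R Q : symmetric h -> R \subset U -> Q \subset U ->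
  U \subset C :|: (R :|: Q) ->
  cnt h U U <= cnt h Q Q + cnt h R R + 2 * cnt h R Q + 2 * cnt h C U.
Proof.
move=> hC sR sQ sU.
have h1 := cntS h sU (subxx U); have h2 := cntUl h C (R :|: Q) U.
have h3 := cntS h (subxx (R :|: Q)) sU; have h4 := cntUr h (R :|: Q) C (R :|: Q).
have sRQ : R :|: Q \subset U by rewrite subUset sR.
have h5 : cnt h (R :|: Q) C <= cnt h C U by rewrite cntC // cntS.
have h6 := cntUl h R Q (R :|: Q); have h7 := cntUr h R R Q; have h8 := cntUr h Q R Q.
have h9 := cntC Q R hC; lia.
Qed.

Lemma cnt_cut1 h U C R : symmetric h -> R \subset U -> U \subset C :|: R ->
  cnt h U U <= cnt h R R + 2 * cnt h C U.
Proof.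
move=> hC sR sU; have e0 B : cnt h B set0 = 0 by apply: cnt_eq0 => x y _; rewrite inE.
have := @cnt_cut h U C R set0 hC sR (sub0set _); rewrite setU0 => /(_ sU).
by rewrite !e0 muln0 add0n addn0.
Qed.

Fixpoint has_matching h k A : Prop :=
  if k is k'.+1 then exists x y, [/\ x \in A, y \in A, x != y, h x y &
    has_matching h k' (A :\ x :\ y)] else True.

(** A [k]-matching has only [2 * k] ends, so [a] keeps a neighbour off it. The induction peels off
    one matching edge at a time, which costs [a] at most two neighbours. *)
Lemma has_matching_star h k A a : irreflexive h -> a \in A -> 2 * k < cnt h [set a] A ->
  has_matching h k (A :\ a) -> has_matching h k.+1 A.
Proof.
move=> h0; elim: k A => [|k IHk] A aA.
  rewrite cnt1 => /card_gt0P[y]; rewrite inE => /andP[yA hay] _.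
  by exists a, y; split=> //; apply: contraTneq hay => ->; rewrite h0.
move=> hd [x [y [xA yA nxy hxy hM]]]; move: xA yA; rewrite !inE => /andP[nxa xA] /andP[nya yA].
exists x, y; split=> //; apply: IHk.
- by rewrite !inE aA eq_sym nya eq_sym nxa.
- have sA : A \subset [set x] :|: ([set y] :|: (A :\ x :\ y)).
    by apply/subsetP => z zA; rewrite !inE zA; do 2?case: eqP => //=.
  have := cntS h (subxx [set a]) sA.
  have := cntUr h [set a] [set x] ([set y] :|: (A :\ x :\ y)).
  have := cntUr h [set a] [set y] (A :\ x :\ y).
  by have := cnt1_le h a [set x]; have := cnt1_le h a [set y]; rewrite !cards1; lia.
- suff -> : A :\ x :\ y :\ a = A :\ a :\ x :\ y by [].
  by apply/setP => z; rewrite !inE; do 3!case: eqP.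
Qed.

(** Greedy argument: the two ends of any edge meet at most [4 * d] ordered pairs, and deleting them
    lowers the matching number. *)
Lemma matching_cnt_deg h k d A : symmetric h -> irreflexive h ->
  (forall x, x \in A -> cnt h [set x] A <= d) ->
  ~ has_matching h k.+1 A -> cnt h A A <= 4 * k * d.
Proof.
move=> hC h0; elim: k A => [|k IHk] A hd hM.
  rewrite cnt_eq0 // => x y xA yA; apply/negP => hxy; case: hM.
  by exists x, y; split=> //; apply: contraTneq hxy => ->; rewrite h0.
have [/existsP[x /existsP[y /and3P[xA yA hxy]]]|hN] :=
    boolP [exists x, exists y, [&& x \in A, y \in A & h x y]]; last first.
  rewrite cnt_eq0 // => x y xA yA; apply: contra hN => hxy.
  by apply/existsP; exists x; apply/existsP; exists y; rewrite xA yA.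
have sAA : A :\ x :\ y \subset A by apply/subsetP => z; rewrite !inE => /and3P[].
have nxy : x != y by apply: contraTneq hxy => ->; rewrite h0.
have {}hM : ~ has_matching h k.+1 (A :\ x :\ y) by move=> ?; apply: hM; exists x, y.
have IH : cnt h (A :\ x :\ y) (A :\ x :\ y) <= 4 * k * d.
  apply: IHk hM => z zA; apply: leq_trans (hd z (subsetP sAA z zA)); exact: cntS.
have sA : A \subset [set x; y] :|: (A :\ x :\ y).
  by apply/subsetP => z zA; rewrite !inE zA; do 2?case: eqP.
have := cnt_cut1 hC sAA sA; have := cntUl h [set x] [set y] A; have := hd x xA; have := hd y yA.
rewrite mulnS mulnDl; lia.
Qed.

(* A vertex of degree more than [2 * k] extends every [k]-matching avoiding it;
   without such a vertex, the [2 * k] ends of a maximal matching meet few edges. *)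
Lemma matching_cnt h k d A : symmetric h -> irreflexive h -> 4 * k <= d ->
  (forall x, x \in A -> cnt h [set x] A <= d) ->
  ~ has_matching h k.+1 A -> cnt h A A <= 2 * k * d.
Proof.
move=> hC h0; elim: k A => [|k IHk] A hk hd hM.
  by have := matching_cnt_deg hC h0 hd hM.
have [/existsP[a /andP[aA ha]]|hN] :=
    boolP [exists a, (a \in A) && (2 * k.+1 < cnt h [set a] A)]; last first.
  have h2 x : x \in A -> cnt h [set x] A <= 2 * k.+1.
    move=> xA; rewrite leqNgt; apply: contra hN => hx.
    by apply/existsP; exists x; rewrite xA.
  (* With all degrees at most [2 * k.+1] the greedy bound is [8 * k.+1 ^ 2]; the hypothesis
     [4 * k.+1 <= d] turns it into the claim. *)
  by apply: leq_trans (matching_cnt_deg hC h0 h2 hM) _; nia.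
have sAA : A :\ a \subset A by apply/subsetP => z; rewrite !inE => /andP[].
have {}hM : ~ has_matching h k.+1 (A :\ a).
  by move=> hM'; apply: hM; apply: (@has_matching_star _ _ _ a).
have IH : cnt h (A :\ a) (A :\ a) <= 2 * k * d.
  apply: IHk hM; first lia.
  move=> z zA; apply: leq_trans (hd z (subsetP sAA z zA)); exact: cntS.
have sA : A \subset [set a] :|: (A :\ a).
  by apply/subsetP => z zA; rewrite !inE zA; case: eqP.
have := cnt_cut1 hC sAA sA; have := hd a aA.
rewrite mulnS mulnDl; lia.
Qed.

End Counting.

(** * Arithmetic of the bound *)

(* Twice the extremal number, before rounding, with [q = n - 1]. *)
Definition turan_bound q p : nat :=
  let k := p %/ q in let r := p %% q in
  maxn (k * (q * q.-1) + r * r.-1)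
       (if k is k'.+1 then k' * (q * q.-1) + (q - 4) * (q + r) else 0).

Lemma turan_boundE q k r : r < q -> turan_bound q (k * q + r) =
  maxn (k * (q * q.-1) + r * r.-1)
       (if k is k'.+1 then k' * (q * q.-1) + (q - 4) * (q + r) else 0).
Proof.
by move=> rq; rewrite /turan_bound divnMDl ?modnMDl ?divn_small ?modn_small ?addn0 //; lia.
Qed.

(** This and the next identity trade truncated subtraction inside products for plain monomials,
    which linear arithmetic can then compare. *)
Lemma sqr_pred r : r * r.-1 + r = r * r.
Proof. by case: r => // r; rewrite mulSnr; lia. Qed.

Lemma mul_sub4 q x : 4 <= q -> (q - 4) * x + 4 * x = q * x.
Proof. by move=> q4; rewrite -mulnDl subnK. Qed.

Lemma turan_bound_add_q q b : 0 < q -> turan_bound q b + q * q.-1 <= turan_bound q (q + b).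
Proof.
move=> q0; rewrite [in X in X <= _](divn_eq b q) [in X in _ <= X](divn_eq b q) addnA -mulSn.
by rewrite !turan_boundE ?ltn_mod //; case: (b %/ q) => [|k]; rewrite ?mulSn; lia.
Qed.

(** Superadditivity against a clique on [a] vertices: with [r] the remainder of [b], either [a + r]
    stays below [q] or it completes one more block. *)
Lemma turan_bound_add_small q a b : 9 <= q -> a < q ->
  turan_bound q b + a * a.-1 <= turan_bound q (a + b).
Proof.
move=> q9 aq; rewrite (divn_eq b q); move: (b %/ q) (b %% q) (ltn_pmod b (ltac:(lia) : 0 < q)).
move=> k r rq; rewrite turan_boundE //.
have e1 := sqr_pred a; have e2 := sqr_pred r; have e4 := sqr_pred q.
have [ar|ar] := ltnP (a + r) q.
  rewrite (_ : a + _ = k * q + (a + r)); last lia.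
  rewrite turan_boundE //.
  have e3 := sqr_pred (a + r).
  have h1 : a * a.-1 + r * r.-1 <= (a + r) * (a + r).-1 by lia.
  case: k => [|k]; first lia.
  (* For [a <= q - 3] the clique degree [a - 1] is at most [q - 4], so the second branch grows
     enough. Otherwise [r <= 1], and there the clique branch dominates. *)
  have [a4|a4] := leqP a (q - 3).
    have h2 : a * a.-1 <= (q - 4) * a by rewrite mulnC leq_mul //; lia.
    have h3 : (q - 4) * (q + (a + r)) = (q - 4) * (q + r) + (q - 4) * a by lia.
    lia.
  have h2 : (q - 4) * (q + r) <= q * q.-1 + r * r.-1.
    have := @mul_sub4 q (q + r) (ltac:(lia)).
    by have [->|->] : r = 0 \/ r = 1; lia.
  rewrite mulSn; lia.
rewrite (_ : a + _ = k.+1 * q + (a + r - q)); last by rewrite mulSn; lia.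
rewrite turan_boundE; last lia.
have [s es] : exists s, a + r = q + s by exists (a + r - q); lia.
have [i ei] : exists i, q = a + i by exists (q - a); lia.
have er : r = s + i by lia.
have si : s * i <= a * i by rewrite leq_mul2r; lia.
rewrite es addKn.
have e3 := sqr_pred s.
(* Convexity: [a + r = q + s], and the pair [q], [s] is more spread out than [a], [r]. *)
have h1 : a * a.-1 + r * r.-1 <= q * q.-1 + s * s.-1 by rewrite er ei in e2 e4 *; lia.
case: k => [|k]; first lia.
have h2 : (q - 4) * (q + r) + a * a.-1 <= q * q.-1 + (q - 4) * (q + s).
  rewrite er (addnA q) (mulnDr _ (q + s)); have := @mul_sub4 q i (ltac:(lia)).
  move: e4; rewrite ei; lia.
rewrite !mulSn; lia.
Qed.

Lemma turan_bound_add_le q a b : 9 <= q -> a <= q -> turan_bound q b + a * a.-1 <= turan_bound q (a + b).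
Proof.
move=> q9; rewrite leq_eqVlt => /predU1P[->|]; first by apply: turan_bound_add_q; lia.
exact: turan_bound_add_small.
Qed.

(** Fill the [d.+1] new vertices with [k] cliques on [q] vertices and one on [r]. Each full clique
    exceeds [6 * q] by at least 6, and [(r - 3) * (r - 4) >= 0] bounds the shortfall of the last one
    by 12; [6 * d = 6 * d.+1 - 6] and [k >= 1] settle the balance. *)
Lemma turan_bound_add_large q d b : 9 <= q -> q <= d -> turan_bound q b + 6 * d <= turan_bound q (d.+1 + b).
Proof.
move=> q9 qd; rewrite (divn_eq d.+1 q).
have: 0 < d.+1 %/ q by rewrite divn_gt0; lia.
have := divn_eq d.+1 q.
move: (d.+1 %/ q) (d.+1 %% q) (ltn_pmod d.+1 (ltac:(lia) : 0 < q)) => k r rq ed k0.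
have h k' : turan_bound q b + r * r.-1 + k' * (q * q.-1) <= turan_bound q (k' * q + r + b).
  elim: k' => [|k' IH]; first by rewrite !addn0 add0n; apply: turan_bound_add_small.
  rewrite !mulSn -!addnA; have := turan_bound_add_q (k' * q + (r + b)) (ltac:(lia) : 0 < q).
  rewrite -!addnA in IH *; lia.
apply: leq_trans (h k).
have h1 : 6 * r <= r * r.-1 + 12.
  have e1 := sqr_pred r; have [r4|r4] := leqP r 3; first by case: r r4 {rq ed h e1} => [|[|[|[|]]]].
  have [w ew] : exists w, r = 4 + w by exists (r - 4); lia.
  by rewrite ew in e1 *; lia.
have h2 : 6 * q + 6 <= q * q.-1.
  by apply: leq_trans (_ : q * 8 <= _); [lia|rewrite leq_mul2l; lia].
have h3 : k * (6 * q + 6) <= k * (q * q.-1) by rewrite leq_mul2l h2 orbT.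
lia.
Qed.

(** The extra 2 pays for the one surplus edge in the case of two covering vertices inside the
    neighbourhood. For [b] a positive multiple of [q] the bound grows by exactly
    [(q - 2) * (q - 3)], whence the hypothesis. *)
Lemma turan_bound_add_strict q b : 9 <= q -> b %% q != 0 ->
  turan_bound q b + (q - 2) * (q - 3) + 2 <= turan_bound q (q - 2 + b).
Proof.
move=> q9; rewrite {2 3}(divn_eq b q); move: (b %/ q) (b %% q) (ltn_pmod b (ltac:(lia) : 0 < q)).
move=> k r rq; rewrite -lt0n => r0; rewrite turan_boundE //.
have e2 := sqr_pred r; have e4 := sqr_pred q.
have e5 : (q - 2) * (q - 3) + 5 * q = q * q + 6.
  have [u ->] : exists u, q = 3 + u by exists (q - 3); lia.
  by rewrite addKn (_ : 3 + u - 2 = u.+1); lia.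
have [r1|r1] : r = 1 \/ 2 <= r by lia.
  rewrite r1 (_ : q - 2 + _ = k * q + (q - 1)); last lia.
  rewrite turan_boundE; last lia.
  have e6 : (q - 1) * (q - 1).-1 + 3 * q = q * q + 2.
    have [u ->] : exists u, q = 2 + u by exists (q - 2); lia.
    by rewrite (_ : 2 + u - 1 = u.+1) /=; lia.
  have e7 := @mul_sub4 q (q + 1) (ltac:(lia)).
  case: k => [|k]; first lia.
  rewrite mulSn; lia.
rewrite (_ : q - 2 + _ = k.+1 * q + (r - 2)); last by rewrite mulSn; lia.
rewrite turan_boundE; last lia.
have e6 : (r - 2) * (r - 2).-1 + 5 * r = r * r + 6.
  have [u ->] : exists u, r = 2 + u by exists (r - 2); lia.
  rewrite addKn; have := sqr_pred u; lia.
have h1 : (q - 2) * (q - 3) + r * r.-1 + 2 <= q * q.-1 + (r - 2) * (r - 2).-1 by lia.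
case: k => [|k]; first lia.
have h2 : (q - 4) * (q + r) + (q - 2) * (q - 3) + 2 <= q * q.-1 + (q - 4) * (q + (r - 2)).
  have -> : q + r = q + (r - 2) + 2 by lia.
  rewrite mulnDr; lia.
rewrite !mulSn; lia.
Qed.

(** Complementary case, with a degree sum in place of the inductive bound: cliques on [q] vertices
    have degree [q - 1], so degree at most [q - 3] leaves [2 * b] to spare. *)
Lemma turan_bound_add_dvd q b : 9 <= q -> b %% q = 0 -> 0 < b ->
  (q - 3) * b + (q - 2) * (q - 3) + 2 <= turan_bound q (q - 2 + b).
Proof.
move=> q9; rewrite {2 3 4}(divn_eq b q) => -> /[!addn0]; move: (b %/ q) => k k0.
have {}k0 : 0 < k by lia.
rewrite [in X in _ <= X]addnC turan_boundE; last lia.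
have -> : (q - 2).-1 = q - 3 by lia.
have : k * (q * q.-1) = (q - 3) * (k * q) + 2 * (k * q).
  rewrite -mulnDl (_ : q - 3 + 2 = q.-1); lia.
have : 1 * 1 <= k * q by rewrite leq_mul; lia.
lia.
Qed.

Lemma turan_bound_deg q p : 9 <= q -> q <= p -> (q - 4) * p <= turan_bound q p.
Proof.
move=> q9; rewrite {1 2 3}(divn_eq p q); move: (p %/ q) (p %% q) (ltn_pmod p (ltac:(lia) : 0 < q)).
move=> k r rq kq; rewrite turan_boundE //; case: k kq => [|k] kq; first lia.
have : k * (q * (q - 4)) <= k * (q * q.-1) by rewrite !leq_mul; lia.
rewrite mulSn !mulnDr; lia.
Qed.

(** * Konig's theorem for matching number at most two *)

Section Konig.
Variables (T : finType) (g : rel T).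
Implicit Types A B XA XB : {set T}.

Definition covers A B XA XB :=
  [/\ XA \subset A, XB \subset B &
      forall x y, x \in A -> y \in B -> g x y -> (x \in XA) || (y \in XB)].

(** If some [x] has two neighbours, an edge avoiding [x] would be disjoint from one of its two
    edges, so [x] covers. Otherwise the [B]-end of any single edge covers. *)
Lemma konig1 A B :
  (forall x1 y1 x2 y2, x1 \in A -> x2 \in A -> y1 \in B -> y2 \in B ->
     x1 != x2 -> y1 != y2 -> g x1 y1 -> g x2 y2 -> False) ->
  exists XA XB, covers A B XA XB /\ #|XA| + #|XB| <= 1.
Proof.
move=> h2.
case: (boolP [exists x in A, exists y in B, exists z in B, [&& y != z, g x y & g x z]]).
  case/exists_inP=> x xA /exists_inP[y yB /exists_inP[z zB /and3P[yz gy gz]]].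
  exists [set x], set0; rewrite cards1 cards0; split=> //; split; rewrite ?sub0set ?sub1set //.
  move=> x' y' x'A y'B gx'; rewrite !inE orbF; apply/negPn/negP => nx.
  have [e|ne] := eqVneq y' y; last by apply: (h2 x' y' x y).
  by apply: (h2 x' y' x z) => //; rewrite e.
move=> hN; case: (boolP [exists x in A, exists y in B, g x y]).
  case/exists_inP=> x xA /exists_inP[y yB gxy].
  exists set0, [set y]; rewrite cards1 cards0; split=> //; split; rewrite ?sub0set ?sub1set //.
  move=> x' y' x'A y'B gx'; rewrite !inE; apply/negPn/negP => ny.
  have [e|ne] := eqVneq x' x; last by apply: (h2 x' y' x y).
  move/negP: hN; apply; apply/exists_inP; exists x => //; apply/exists_inP; exists y => //.
  by apply/exists_inP; exists y' => //; rewrite gxy eq_sym ny -e gx'.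
move=> hN'; exists set0, set0; rewrite !cards0; split=> //; split; rewrite ?sub0set //.
move=> x y xA yB gxy; move/negP: hN'; case.
by apply/exists_inP; exists x => //; apply/exists_inP; exists y.
Qed.

(** Starting from a 2-matching [x1 y1], [x2 y2], look for augmenting paths: [up] and [down] mark
    vertices with a neighbour off the matching. If no [yi] is [up], the [xi] cover; if no [xi] is
    [down], the [yi] cover; otherwise the cover takes one vertex from each side. *)
Lemma konig2 A B :
  (forall x1 y1 x2 y2 x3 y3, x1 \in A -> x2 \in A -> x3 \in A ->
     y1 \in B -> y2 \in B -> y3 \in B -> uniq [:: x1; x2; x3] -> uniq [:: y1; y2; y3] ->
     g x1 y1 -> g x2 y2 -> g x3 y3 -> False) ->
  exists XA XB, covers A B XA XB /\ #|XA| + #|XB| <= 2.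
Proof.
move=> h3.
pose P x1 y1 x2 y2 := [&& x1 \in A, x2 \in A, y1 \in B & y2 \in B] &&
    [&& x1 != x2, y1 != y2, g x1 y1 & g x2 y2].
case: (boolP [exists x1, exists y1, exists x2, exists y2, P x1 y1 x2 y2]); last first.
  move=> hN; have [|XA [XB [hc hs]]] := @konig1 A B; last by exists XA, XB; split=> //; lia.
  move=> x1 y1 x2 y2 x1A x2A y1B y2B nx ny g1 g2; move/negP: hN; case.
  apply/existsP; exists x1; apply/existsP; exists y1; apply/existsP; exists x2.
  by apply/existsP; exists y2; rewrite /P; apply/andP; split; apply/and4P.
case/existsP=> x1 /existsP[y1 /existsP[x2 /existsP[y2]]].
case/andP=> /and4P[x1A x2A y1B y2B] /and4P[nx ny g1 g2].
have c2 (a b : T) : a != b -> #|[set a; b]| = 2 by rewrite cards2 => ->.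
have h3' x y x' y' x'' y'' : x \in A -> y \in B -> x' \in A -> y' \in B -> x'' \in A ->
    y'' \in B -> x != x' -> x != x'' -> x' != x'' -> y != y' -> y != y'' -> y' != y'' ->
    g x y -> g x' y' -> g x'' y'' -> False.
  move=> *; apply: (h3 x y x' y' x'' y'') => //=; rewrite !inE negb_or; apply/and3P; split=> //;
  by apply/andP.
pose up w := [exists x in A, [&& x != x1, x != x2 & g x w]].
pose down x := [exists y in B, [&& y != y1, y != y2 & g x y]].
have upP w : up w -> exists x, [/\ x \in A, x != x1, x != x2 & g x w].
  by case/exists_inP=> x xA /and3P[]; exists x.
have downP x : down x -> exists y, [/\ y \in B, y != y1, y != y2 & g x y].
  by case/exists_inP=> y yB /and3P[]; exists y.
have outN x y : x \in A -> y \in B -> x != x1 -> x != x2 -> y != y1 -> y != y2 -> ~~ g x y.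
  move=> xA yB nx1 nx2 ny1 ny2; apply/negP => gxy.
  by apply: (h3' x y x1 y1 x2 y2).
have mem_up x y : x \in A -> x != x1 -> x != x2 -> g x y -> up y.
  by move=> xA nx1 nx2 gxy; apply/exists_inP; exists x => //; rewrite nx1 nx2.
have mem_down x y : y \in B -> y != y1 -> y != y2 -> g x y -> down x.
  by move=> yB ny1 ny2 gxy; apply/exists_inP; exists y => //; rewrite ny1 ny2.
have [/norP[nu1 nu2]|u12] := boolP (~~ (up y1 || up y2)).
  exists [set x1; x2], set0; rewrite c2 // cards0; split=> //; split; rewrite ?sub0set //.
    by apply/subsetP => z /set2P[->|->].
  move=> x y xA yB gxy; rewrite !inE orbF; apply/negPn/negP => /norP[nx1 nx2].
  have [e|ne1] := eqVneq y y1; first by move/negP: nu1; apply; rewrite -e (mem_up x).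
  have [e|ne2] := eqVneq y y2; first by move/negP: nu2; apply; rewrite -e (mem_up x).
  by move/negP: (outN x y xA yB nx1 nx2 ne1 ne2).
have [/norP[nd1 nd2]|d12] := boolP (~~ (down x1 || down x2)).
  exists set0, [set y1; y2]; rewrite c2 // cards0; split=> //; split; rewrite ?sub0set //.
    by apply/subsetP => z /set2P[->|->].
  move=> x y xA yB gxy; rewrite !inE /=; apply/negPn/negP => /norP[ny1 ny2].
  have [e|ne1] := eqVneq x x1; first by move/negP: nd1; apply; rewrite -e (mem_down _ y).
  have [e|ne2] := eqVneq x x2; first by move/negP: nd2; apply; rewrite -e (mem_down _ y).
  by move/negP: (outN x y xA yB ne1 ne2 ny1 ny2).
(* The alternating paths: [up yi] and [down xi] together augment the edge [xi yi]. *)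
have aug a b c d : a \in A -> c \in A -> b \in B -> d \in B -> a != c -> b != d ->
    g a b -> g c d -> [set a; c] = [set x1; x2] -> [set b; d] = [set y1; y2] ->
    up b -> down a -> False.
  move=> aA cA bB dB nac nbd gab gcd ex ey /upP[x [xA nx1 nx2 gx]] /downP[y [yB ny1 ny2 gy]].
  have xN : x \notin [set a; c] by rewrite ex !inE negb_or nx1.
  have yN : y \notin [set b; d] by rewrite ey !inE negb_or ny1.
  rewrite !inE !negb_or in xN yN; case/andP: xN => xa xc; case/andP: yN => yb yd.
  by apply: (h3' x b a y c d) => //; rewrite eq_sym.
(* The crossed case, with cover [c], [b]. An uncovered edge other than [a d] would feed [aug] or
   avoid the matching; [a d] itself would give the augmenting path [x0 b a d c y0]. *)
have aug' a b c d : a \in A -> c \in A -> b \in B -> d \in B -> a != c -> b != d ->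
    g a b -> g c d -> [set a; c] = [set x1; x2] -> [set b; d] = [set y1; y2] ->
    up b -> down c ->
  exists XA XB, covers A B XA XB /\ #|XA| + #|XB| <= 2.
  move=> aA cA bB dB nac nbd gab gcd ex ey ub dc.
  have := upP _ ub; case=> x0 [x0A nx01 nx02 gx0]; have := downP _ dc; case=> y0 [y0B ny01 ny02 gy0].
  have x0N : x0 \notin [set a; c] by rewrite ex !inE negb_or nx01.
  have y0N : y0 \notin [set b; d] by rewrite ey !inE negb_or ny01.
  rewrite !inE !negb_or in x0N y0N; case/andP: x0N => xa xc; case/andP: y0N => yb yd.
  exists [set c], [set b]; rewrite !cards1; split=> //; split; rewrite ?sub1set //.
  move=> x y xA yB gxy; rewrite !inE; apply/negPn/negP => /norP[nxc nyb].
  have [exa|nxa] := eqVneq x a.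
    have [eyd|nyd] := eqVneq y d.
      by apply: (h3' x0 b a d c y0) => //; rewrite 1?eq_sym // -?exa -?eyd // eq_sym.
    have yN : y \notin [set y1; y2] by rewrite -ey !inE negb_or nyb.
    rewrite !inE negb_or in yN; case/andP: yN => ny1 ny2.
    by apply: (aug a b c d) => //; rewrite -exa (mem_down _ y).
  have xN : x \notin [set x1; x2] by rewrite -ex !inE negb_or nxa.
  rewrite !inE negb_or in xN; case/andP: xN => nx1 nx2.
  have [eyd|nyd] := eqVneq y d.
    by apply: (aug c d a b) => //; rewrite 1?eq_sym // 1?setUC // -eyd (mem_up x).
  have yN : y \notin [set y1; y2] by rewrite -ey !inE negb_or nyb.
  rewrite !inE negb_or in yN; case/andP: yN => ny1 ny2.
  by move/negP: (outN x y xA yB nx1 nx2 ny1 ny2).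
have := setUC [set x1] [set x2]; have := setUC [set y1] [set y2] => ey ex.
case/orP: (negbNE u12) => u; case/orP: (negbNE d12) => d.
- by case: (aug x1 y1 x2 y2).
- by apply: (aug' x1 y1 x2 y2).
- by apply: (aug' x2 y2 x1 y1) => //; rewrite eq_sym.
- by case: (aug x2 y2 x1 y1) => //; rewrite eq_sym.
Qed.

End Konig.

(** * Edges around a vertex of maximal degree *)

Section Pointwise.
Variable T : finType.
Implicit Types (h : rel T) (A B : {set T}).

Lemma cnt_mkcond h A B :
  cnt h A B = \sum_x \sum_y [&& x \in A, y \in B & h x y].
Proof.
rewrite /cnt big_mkcond; apply: eq_bigr => x _; case: (x \in A) => /=; last by rewrite big1.
by rewrite big_mkcond; apply: eq_bigr => y _; case: (y \in B).
Qed.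

Lemma cnt_leD h h1 h2 A B A1 B1 A2 B2 :
  (forall x y, x \in A -> y \in B -> h x y ->
     [&& x \in A1, y \in B1 & h1 x y] || [&& x \in A2, y \in B2 & h2 x y]) ->
  cnt h A B <= cnt h1 A1 B1 + cnt h2 A2 B2.
Proof.
move=> hh; rewrite !cnt_mkcond -big_split; apply: leq_sum => x _ /=.
rewrite -big_split; apply: leq_sum => y _ /=.
case: and3P => // -[xA yB hxy]; have := hh x y xA yB hxy.
by case: [&& x \in A1, _ & _]; case: [&& x \in A2, _ & _].
Qed.

End Pointwise.

(* With [q = n - 1]: completing [v x_i y_i] to a copy of [T_n'''] takes [n - 7 = q - 6]
   further neighbours of [v]. *)
Definition spider_free (T : finType) (g : rel T) q (U : {set T}) :=
  forall v x1 x2 x3 y1 y2 y3, [set v; x1; x2; x3; y1; y2; y3] \subset U ->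
  uniq [:: v; x1; x2; x3; y1; y2; y3] ->
  g v x1 -> g v x2 -> g v x3 -> g x1 y1 -> g x2 y2 -> g x3 y3 ->
  #|[set z in U | g v z] :\: [set x1; x2; x3; y1; y2; y3]| + 6 < q.

Lemma spider_freeS (T : finType) (g : rel T) q (U U' : {set T}) :
  U' \subset U -> spider_free g q U -> spider_free g q U'.
Proof.
move=> sU hU v x1 x2 x3 y1 y2 y3 sV *.
apply: leq_ltn_trans (hU v x1 x2 x3 y1 y2 y3 _ _ _ _ _ _ _ _) => //.
  rewrite leq_add2r subset_leq_card // setSD //; apply/subsetP => z.
  by rewrite !inE => /andP[/(subsetP sU) -> ->].
exact: subset_trans sV sU.
Qed.

Section Center.
Variables (T : finType) (g : rel T) (gC : symmetric g) (g0 : irreflexive g).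
Implicit Types A XA XB : {set T}.
Variables (U : {set T}) (v : T).
Hypothesis vU : v \in U.
Let N := [set y in U | g v y].
Let W := U :\ v :\: N.
Let D := #|N|.
Hypothesis Dmax : forall x, x \in U -> cnt g [set x] U <= D.

Lemma mem_nbhd x : x \in N -> [/\ x \in U, g v x & x != v].
Proof. by rewrite inE => /andP[xU gx]; split=> //; apply: contraTneq gx => ->; rewrite g0. Qed.

Lemma mem_nonnbhd x : x \in W -> [/\ x \in U, x != v & x \notin N].
Proof. by rewrite !inE => /and3P[]. Qed.

Lemma card_parts : #|U| = #|W| + D.+1.
Proof.
rewrite (cardsD1 v U) vU -(cardsID N (U :\ v)) -/W (setIidPr _) -/D; first by clear; lia.
by apply/subsetP => x /mem_nbhd[xU _ xv]; rewrite !inE xv.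
Qed.

(** Once the cover is deleted, no edge joins [v |: (N :\: XA)] to [W :\: XB]. The former is bounded
    by a complete graph, and each covering vertex costs at most [D] edges. *)
Lemma cover_cut XA XB : covers g N W XA XB -> cnt g U U <=
  cnt g (W :\: XB) (W :\: XB) + (D.+1 - #|XA|) * (D - #|XA|) + 2 * (#|XA| + #|XB|) * D.
Proof.
case=> sA sB hc.
have sAU : XA \subset U by apply: subset_trans sA _; apply/subsetP => x /mem_nbhd[].
have sBU : XB \subset U by apply: subset_trans sB _; apply/subsetP => x /mem_nonnbhd[].
pose R := v |: (N :\: XA).
have sRU : R \subset U.
  by apply/subsetP => x; rewrite !inE => /orP[/eqP->//|/and3P[]].
have sQU : W :\: XB \subset U by apply/subsetP => x; rewrite !inE => /and4P[].
have sU : U \subset (XA :|: XB) :|: (R :|: (W :\: XB)).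
  apply/subsetP => x xU; rewrite !inE xU /=.
  by case: (x \in XA); case: (x \in XB); case: (x == v); case: (g v x).
have := cnt_cut gC sRU sQU sU.
have -> : cnt g R (W :\: XB) = 0.
  apply: cnt_eq0 => x y; rewrite in_setU1 in_setD => xR; rewrite in_setD => /andP[yB yW].
  case/orP: xR => [/eqP->|/andP[xA xN]].
    by have [yU _] := mem_nonnbhd yW; rewrite inE yU.
  by apply: contraNN yB => gxy; have := hc x y xN yW gxy; rewrite (negbTE xA).
have cR : #|R| = D.+1 - #|XA|.
  rewrite cardsU1 !inE g0 andbF andbF /= cardsD (setIidPr sA) -/D.
  have := subset_leq_card sA; rewrite -/D; lia.
have := cnt_complete R g0; rewrite cR.
have -> : (D.+1 - #|XA|).-1 = D - #|XA| by lia.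
have h1 : cnt g (XA :|: XB) U <= (#|XA| + #|XB|) * D.
  apply: leq_trans (cnt_leM (d := D) _) _ => [x xX|].
    by apply: Dmax; move: x xX; apply/subsetP; rewrite subUset sAU.
  by rewrite leq_mul2r cardsU leq_subr orbT.
lia.
Qed.

Definition touching : rel T := fun x y => g x y && ((x \in N) || (y \in N)).

Lemma touchingC : symmetric touching.
Proof. by move=> x y; rewrite /touching gC orbC. Qed.

Lemma touching0 : irreflexive touching.
Proof. by move=> x; rewrite /touching g0. Qed.

Lemma touching_deg x A : x \in U -> A \subset U -> cnt touching [set x] A <= D.
Proof.
move=> xU sA; apply: leq_trans (Dmax xU).
have e0 : cnt g set0 set0 = 0 by apply: cnt_eq0 => ? ?; rewrite inE.
rewrite -[leqRHS]addn0 -[X in _ + X]e0.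
by apply: cnt_leD => z y -> yA /andP[gzy _]; rewrite (subsetP sA _ yA) gzy.
Qed.

(** Orients the first matching edge so that its first end lies in [N], the form that [no_spider]
    expects. *)
Lemma touching_matchingP k A : has_matching touching k.+1 A ->
  exists x y, [/\ x \in A, x \in N, y \in A, g x y & has_matching touching k (A :\ x :\ y)].
Proof.
case=> x [y [xA yA _ /andP[gxy hN] hM]]; case/orP: hN => hN; first by exists x, y.
exists y, x; split=> //; first by rewrite gC.
suff -> : A :\ y :\ x = A :\ x :\ y by [].
by apply/setP => z; rewrite !inE andbCA.
Qed.

Lemma adj_neq x y : g x y -> x != y.
Proof. by apply: contraTneq => ->; rewrite g0. Qed.

Lemma mem_setD_center y : y != v -> y \in U -> y \in U :\ v.
Proof. by rewrite !inE => ->. Qed.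

Lemma cnt_center : cnt g U U <= cnt g (U :\ v) (U :\ v) + 2 * D.
Proof.
have sU : U :\ v \subset U by rewrite subD1set.
have sUv : U \subset [set v] :|: (U :\ v) by rewrite setD1K.
by apply: leq_trans (cnt_cut1 gC sU sUv) _; rewrite leq_add2l leq_mul2l Dmax.
Qed.

Lemma cnt_touching A : A \subset U :\ v -> cnt g A A <= cnt touching A A + cnt g W W.
Proof.
move=> sA; apply: cnt_leD => x y xA yA gxy; rewrite xA yA /touching gxy /=.
have /setD1P[xv xU] := subsetP sA x xA; have /setD1P[yv yU] := subsetP sA y yA.
by rewrite !inE xU yU xv yv; do 2!case: (g v _).
Qed.

Variables (q : nat) (q9 : 9 <= q).
Hypothesis Ufree : spider_free g q U.

(** The six ends use up at most three neighbours of [v] plus one for each [yi] inside [N]; fewer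
    than [q - 6] other neighbours may remain. *)
Lemma no_spider x1 x2 x3 y1 y2 y3 :
  x1 \in N -> x2 \in N -> x3 \in N -> y1 \in U :\ v -> y2 \in U :\ v -> y3 \in U :\ v ->
  uniq [:: x1; x2; x3; y1; y2; y3] -> g x1 y1 -> g x2 y2 -> g x3 y3 ->
  D + 3 < q + ((y1 \in N) + (y2 \in N) + (y3 \in N)).
Proof.
move=> /[dup] /mem_nbhd[x1U gx1 x1v] x1N /[dup] /mem_nbhd[x2U gx2 x2v] x2N.
move=> /[dup] /mem_nbhd[x3U gx3 x3v] x3N.
move=> /setD1P[y1v y1U] /setD1P[y2v y2U] /setD1P[y3v y3U] hu g1 g2 g3.
set S := [set x1; x2; x3; y1; y2; y3].
have lt : #|N :\: S| + 6 < q.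
  apply: Ufree => //.
    apply/subsetP => z; rewrite !inE.
    by repeat case/orP => [|/eqP->//]; move/eqP->.
  rewrite cons_uniq hu andbT !inE !negb_or !(eq_sym v).
  by rewrite x1v x2v x3v y1v y2v y3v.
have c1 y : #|N :&: [set y]| = (y \in N).
  case: (boolP (y \in N)) => yN; first by rewrite (setIidPr _) ?sub1set // cards1.
  by apply/eqP; rewrite cards_eq0 setI_eq0 disjoint_sym disjoints1.
have leS : #|N :&: S| <= 3 + ((y1 \in N) + (y2 \in N) + (y3 \in N)).
  rewrite -!c1 /S !setIUr.
  have c3 x : #|N :&: [set x]| <= 1 by rewrite c1; case: (_ \in _).
  have cU (A B : {set T}) a b : #|A| <= a -> #|B| <= b -> #|A :|: B| <= a + b.
    by move=> ha hb; rewrite (leq_trans (leq_card_setU _ _)) // leq_add.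
  have := cU _ _ _ _ (cU _ _ _ _ (cU _ _ _ _ (cU _ _ _ _ (cU _ _ _ _ (c3 x1) (c3 x2)) (c3 x3))
    (leqnn #|N :&: [set y1]|)) (leqnn #|N :&: [set y2]|)) (leqnn #|N :&: [set y3]|).
  by rewrite !addnA.
have := cardsID S N; rewrite -/D; move: (_ + _ + _)%N leS => m; clear -lt; lia.
Qed.

(** Here [no_spider] excludes a 3-matching even with all three [yi] in [N]. So [matching_cnt] bounds
    the touching pairs off [v] by [4 * D], and [v] adds [2 * D]. *)
Lemma cnt_center_ge_q : q <= D -> cnt g U U <= cnt g W W + 6 * D.
Proof.
move=> qD; have sU : U :\ v \subset U by rewrite subD1set.
have hM : ~ has_matching touching 3 (U :\ v).
  case/touching_matchingP=> x1 [y1 [x1A x1N y1A g1]].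
  case/touching_matchingP=> x2 [y2 [x2A x2N y2A g2]].
  case/touching_matchingP=> x3 [y3 [x3A x3N y3A g3 _]].
  have n1 := adj_neq g1; have n2 := adj_neq g2; have n3 := adj_neq g3.
  move: x2A y2A x3A y3A; rewrite !in_setD1 => /and4P[? ? ? _] /and4P[? ? y2v y2U].
  case/and5P=> ? ? ? ? /andP[? _] /and5P[? ? ? ? /andP[y3v y3U]].
  have hu : uniq [:: x1; x2; x3; y1; y2; y3].
    rewrite /= !inE !negb_or -!andbA; do ?[apply/andP; split] => //; by rewrite eq_sym.
  have := no_spider x1N x2N x3N y1A (mem_setD_center y2v y2U) (mem_setD_center y3v y3U) hu g1 g2 g3.
  by do 3!case: (_ \in N); clear -qD; lia.
have d4 : 4 * 2 <= D by clear -qD q9; lia.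
have := matching_cnt touchingC touching0 d4 _ hM.
have := cnt_center; have := cnt_touching (subxx _).
move=> h1 h2 /(_ (fun z zA => touching_deg (subsetP sU z zA) sU)) h3.
clear -h1 h2 h3; lia.
Qed.

(** Since [w] is outside [N], the edge [x w] and a touching 2-matching off it would be forbidden.
    The [8 * D] is [2 * D] for each of [v], [x], [w] and [2 * D] from [matching_cnt]. *)
Lemma cnt_center_q1 x w : D = q.-1 -> x \in N -> w \in W -> g x w ->
  cnt g U U <= cnt g W W + 8 * D.
Proof.
move=> eD xN wW gxw; pose A := U :\ v :\ x :\ w.
have [xU gvx xv] := mem_nbhd xN; have [wU wv wN] := mem_nonnbhd wW.
have sA : A \subset U by apply/subsetP => z; rewrite !inE => /and4P[].
have sUv : U :\ v \subset U by rewrite subD1set.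
have sUx : U :\ v :\ x \subset U by apply/subsetP => z; rewrite !inE => /and3P[].
have hM : ~ has_matching touching 2 A.
  case/touching_matchingP=> x1 [y1 [x1A x1N y1A g1]].
  case/touching_matchingP=> x2 [y2 [x2A x2N y2A g2 _]].
  have n1 := adj_neq g1; have n2 := adj_neq g2; have n3 := adj_neq gxw.
  move: x1A y1A x2A y2A; rewrite !in_setD1 => /and4P[? ? ? _] /and4P[? ? y1v y1U].
  case/and5P=> ? ? ? ? /andP[? _] /and5P[? ? ? ? /andP[y2v y2U]].
  have hu : uniq [:: x1; x2; x; y1; y2; w].
    rewrite /= !inE !negb_or -!andbA; do ?[apply/andP; split] => //; by rewrite eq_sym.
  have := no_spider x1N x2N xN (mem_setD_center y1v y1U) (mem_setD_center y2v y2U) (mem_setD_center wv wU) hu g1 g2 gxw.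
  by rewrite (negbTE wN); do 2!case: (_ \in N); clear -eD q9; lia.
have d4 : 4 * 1 <= D by clear -eD q9; lia.
have := matching_cnt touchingC touching0 d4 _ hM.
have := cnt_center.
have sv : U :\ v \subset [set x] :|: (U :\ v :\ x) by rewrite setD1K // !inE xv.
have sx : U :\ v :\ x \subset [set w] :|: A.
  by rewrite setD1K // !inE wv wU eq_sym adj_neq.
have := cnt_cut1 gC (subD1set _ _) sv; have := cnt_touching (subD1set (U :\ v) x).
have := cnt_cut1 touchingC (subD1set _ _) sx.
have := touching_deg wU sUx.
have := cntS g (subxx [set x]) sUv; have := Dmax xU.
move=> h1 h2 h3 h4 h5 h6 h7 /(_ (fun z zA => touching_deg (subsetP sA z zA) sA)) h8.
clear -h1 h2 h3 h4 h5 h6 h7 h8; move: h4; rewrite -/A => h4; lia.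
Qed.

(** A trade-off: either [w1] has at most two neighbours in [M], and [x1] at most [D] in all, or the
    neighbours of [x1] are among [v], [w1], [w2], [x2], and the sum is at most [4 + (D - 2)]. *)
Lemma cnt_pair_q2 x1 w1 x2 w2 : D = q.-2 -> x1 \in N -> x2 \in N -> w1 \in W -> w2 \in W ->
  x1 != x2 -> w1 != w2 -> g x1 w1 -> g x2 w2 ->
  cnt g [set x1] U + cnt g [set w1] (N :\ x1 :\ x2) <= D + 2.
Proof.
move=> eD x1N x2N w1W w2W nx nw g1 g2; set M := N :\ x1 :\ x2.
have [x1U gvx1 x1v] := mem_nbhd x1N; have [w1U w1v w1N] := mem_nonnbhd w1W.
have [x2U gvx2 x2v] := mem_nbhd x2N; have [w2U w2v w2N] := mem_nonnbhd w2W.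
have [le2|gt2] := leqP (cnt g [set w1] M) 2; first by rewrite leq_add ?Dmax.
have cM : #|M| + 2 = D.
  by rewrite /D (cardsD1 x1 N) x1N (cardsD1 x2 (N :\ x1)) !inE eq_sym nx x2U gvx2 -/M; clear; lia.
have leM := cnt1_le g w1 M.
suff : cnt g [set x1] U <= 4 by clear -leM cM; lia.
rewrite cnt1; apply: leq_trans (card_size [:: v; w1; w2; x2]).
apply: subset_leq_card; apply/subsetP => z; rewrite !inE => /andP[zU gz].
apply/negPn/negP; rewrite !negb_or => /and4P[zv zw1 zw2 zx2].
(* Otherwise [x1 z], [w1 y] and [x2 w2] form a forbidden matching. *)
have [y /setD1P[yz]] : exists y, y \in [set y in M | g w1 y] :\ z.
  apply/set0Pn; rewrite -card_gt0; rewrite cnt1 (cardsD1 z) in gt2.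
  by case: (z \in _) gt2; clear; lia.
rewrite !inE => /andP[/and4P[yx2 yx1 yU gvy] gwy].
have yN : y \in N by rewrite inE yU.
have [_ _ yv] := mem_nbhd yN.
have nNW a b : a \in N -> b \notin N -> a != b by move=> aN; apply: contraNneq => <-.
have hu : uniq [:: x1; y; x2; z; w1; w2].
  rewrite /= !inE !negb_or nx (adj_neq gz) zw1 zw2 nw yz yx2.
  rewrite !(nNW _ w1) // !(nNW _ w2) // (eq_sym x1) yx1 (eq_sym x2) zx2.
  by [].
have := no_spider x1N yN x2N (mem_setD_center zv zU) (mem_setD_center w1v w1U) (mem_setD_center w2v w2U) hu gz.
by rewrite gC => /(_ gwy g2); rewrite (negbTE w1N) (negbTE w2N); case: (z \in N); clear -eD q9; lia.
Qed.

(** [M] is independent and sends edges into [W] only to [w1] and [w2]. Deleting [v], [x1], [x2]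
    costs [2 * D] for [v]; everything else meeting [N] is paid for by two uses of [cnt_pair_q2]. *)
Lemma cnt_center_q2 x1 w1 x2 w2 : D = q.-2 -> x1 \in N -> x2 \in N -> w1 \in W -> w2 \in W ->
  x1 != x2 -> w1 != w2 -> g x1 w1 -> g x2 w2 ->
  cnt g U U <= cnt g W W + 6 * D + 8.
Proof.
move=> eD x1N x2N w1W w2W nx nw g1 g2; set M := N :\ x1 :\ x2.
have p1 := cnt_pair_q2 eD x1N x2N w1W w2W nx nw g1 g2.
have := cnt_pair_q2 eD x2N x1N w2W w1W; rewrite eq_sym (eq_sym w2) => /(_ nx nw g2 g1).
have -> : N :\ x2 :\ x1 = M by apply/setP => z; rewrite !inE andbCA.
move=> p2.
have [x1U gvx1 x1v] := mem_nbhd x1N; have [w1U w1v w1N] := mem_nonnbhd w1W.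
have [x2U gvx2 x2v] := mem_nbhd x2N; have [w2U w2v w2N] := mem_nonnbhd w2W.
have nNW a b : a \in N -> b \notin N -> a != b by move=> aN; apply: contraNneq => <-.
(* Such an edge would extend [x1 w1], [x2 w2] to a 3-matching with at most one second end in [N]. *)
have out y z : y \in M -> z \in U -> z != v -> z != x1 -> z != x2 -> z != w1 -> z != w2 ->
    ~~ g y z.
  move=> yM zU zv zx1 zx2 zw1 zw2; apply/negP => gyz.
  move: yM; rewrite !in_setD1 => /and3P[yx2 yx1 yN].
  have hu : uniq [:: y; x1; x2; z; w1; w2].
    by rewrite /= !inE !negb_or nx (adj_neq gyz) zw1 zw2 nw yx1 yx2 !(nNW _ w1) // !(nNW _ w2) // !(eq_sym _ z) zx1 zx2.
  have := no_spider yN x1N x2N (mem_setD_center zv zU) (mem_setD_center w1v w1U) (mem_setD_center w2v w2U) hu gyz g1 g2.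
  by rewrite (negbTE w1N) (negbTE w2N); case: (z \in N); clear -eD q9; lia.
have sMU : M \subset U by apply/subsetP => z; rewrite !inE => /and4P[].
have sWU : W \subset U by apply/subsetP => z /mem_nonnbhd[].
have sU : U \subset [set v; x1; x2] :|: (M :|: W).
  apply/subsetP => z zU; rewrite !inE zU /=.
  by case: (z == v); case: (z == x1); case: (z == x2); case: (g v z).
have := cnt_cut gC sMU sWU sU.
have -> : cnt g M M = 0.
  apply: cnt_eq0 => y z yM; rewrite !in_setD1 => /and3P[zx2 zx1 zN].
  have [zU _ zv] := mem_nbhd zN; apply: out => //; exact: nNW.
have hMW : cnt g M W <= cnt g [set w1] M + cnt g [set w2] M.
  rewrite (cntC _ M gC) (cntC _ M gC); apply: cnt_leD => y z yM zW gyz.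
  have [zU zv zN] := mem_nonnbhd zW; rewrite yM !inE gyz !andbT /=.
  apply/negPn/negP => /norP[zw1 zw2].
  suff : ~~ g y z by rewrite gyz.
  by apply: out => //; rewrite eq_sym nNW.
have := cntUl g ([set v] :|: [set x1]) [set x2] U; have := cntUl g [set v] [set x1] U.
have := Dmax vU; rewrite -/M in p1; clear -p1 p2 hMW; lia.
Qed.

End Center.

(** * Induction for the upper bound, by cases on the maximal degree *)

Section UpperBound.
Variables (T : finType) (g : rel T) (gC : symmetric g) (g0 : irreflexive g).
Variables (q : nat) (q9 : 9 <= q).
Implicit Types U N W XA XB : {set T}.

Lemma cnt_spider_free_step U v : v \in U -> spider_free g q U ->
  (forall x, x \in U -> cnt g [set x] U <= cnt g [set v] U) -> q < #|U| ->
  (forall U', U' \subset U -> #|U'| < #|U| -> cnt g U' U' <= turan_bound q #|U'|) ->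
  cnt g U U <= turan_bound q #|U|.
Proof.
move=> vU Ufree vmax qU IH.
rewrite cnt1 in vmax; set N := [set y in U | g v y] in vmax; set D := #|N| in vmax.
pose W := U :\ v :\: N.
have cU : #|U| = #|W| + D.+1 by rewrite (card_parts g0 vU).
have WU : W \subset U by apply/subsetP => x; rewrite !inE => /and3P[].
have IHW XB : XB \subset W -> cnt g (W :\: XB) (W :\: XB) <= turan_bound q (#|W| - #|XB|).
  move=> sB; have -> : #|W| - #|XB| = #|W :\: XB| by rewrite cardsD (setIidPr sB).
  apply: IH.
    exact: subset_trans (subsetDl _ _) WU.
  apply: leq_ltn_trans (subset_leq_card (subsetDl W XB)) _; clear -cU; lia.
have IH0 : cnt g W W <= turan_bound q #|W|.
  by have := IHW _ (sub0set _); rewrite setD0 cards0 subn0.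
have add_le a b : a <= q -> b + a = #|U| -> turan_bound q b + a * a.-1 <= turan_bound q #|U|.
  by move=> aq <-; rewrite (addnC b) turan_bound_add_le.
have [Dlo|Dhi] := leqP D (q - 4).
  apply: leq_trans (turan_bound_deg q9 (ltnW qU)).
  have := cnt_leM (A := U) (B := U) (h := g) vmax; clear -Dlo; nia.
(* Removing [v], [N] and [XB] takes [D + 1 + #|XB|] vertices, at most [q], so the loss is compared
   with a clique on as many vertices. With a cover of size at most two this fails only for
   [#|XA| = 2], [#|XB| = 0], by one edge. *)
have cover XA XB : covers g N W XA XB ->
    #|XA| + #|XB| <= q.-1 - D -> D < q ->
    cnt g U U <= turan_bound q #|U| \/ #|XA| = 2 /\ #|XB| = 0.
  move=> hc; have := cover_cut gC g0 vU vmax hc; rewrite -/N -/W -/D.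
  case: hc => sA sB _; have := IHW XB sB; have := subset_leq_card sB.
  have := @add_le (D + #|XB|).+1 (#|W| - #|XB|).
  move: #|XA| #|XB| (cnt g (W :\: XB) _) (cnt g U U) => i j c c' h1 jW h2 h3 hij Dq.
  have {}h1 := h1 (ltac:(clear -hij Dq; lia)) (ltac:(clear -jW cU; lia)).
  have [[-> ->]|ij] : (i = 2 /\ j = 0) \/ ~ (i = 2 /\ j = 0) by clear; lia.
    by right.
  left; apply: leq_trans h3 _; apply: leq_trans h1; rewrite -addnA; apply: leq_add => //.
  have : i + j <= 2 by clear -hij Dhi Dq; lia.
  have [d ->] : exists d, D = 2 + d by exists (D - 2); clear -Dhi q9; lia.
  move=> ij2; rewrite (_ : (2 + d).+1 - i = (d + (2 - i)).+1); last by clear -ij2; lia.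
  rewrite (_ : 2 + d - i = d + (2 - i)); last by clear -ij2; lia.
  have : (i = 0 /\ j <= 2) \/ (i = 1 /\ j <= 1) by clear -ij ij2; lia.
  rewrite [_.+1.-1]/=; clear; case=> -[->].
    by case: j => [|[|[|]]] // _; lia.
  by case: j => [|[|]] // _; lia.
have [DQ|Dq] := leqP q D.
  have := cnt_center_ge_q gC g0 vU vmax q9 Ufree DQ; rewrite -/N -/W -/D => h1.
  have := turan_bound_add_large #|W| q9 DQ; rewrite addnC [_.+1 + _]addnC -cU; clear -h1 IH0; lia.
have sNU : N \subset U :\ v.
  by apply/subsetP => x; rewrite !inE => /andP[-> gx]; rewrite andbT eq_sym (adj_neq g0).
have sWv : W \subset U :\ v by apply: subsetDl.
have WN x : x \in W -> (x \in N) = false by rewrite in_setD => /andP[/negbTE].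
have nNW a b : a \in N -> b \in W -> a != b.
  by move=> aN /WN; apply: contraFneq => <-.
have [D1|D2] := leqP q.-1 D.
  have eD : D = q.-1 by clear -D1 Dq; lia.
  have [/exists_inP[x xN /exists_inP[w wW gxw]]|hN] := boolP [exists x in N, exists w in W, g x w].
    have := cnt_center_q1 gC g0 vU vmax q9 Ufree eD xN wW gxw; rewrite -/N -/W -/D => h1.
    have h3 := add_le D.+1 #|W| (ltac:(clear -eD q9; lia)) (esym cU).
    apply: leq_trans h3; apply: leq_trans h1 _; rewrite leq_add // leq_mul2r.
    by clear -eD q9; lia.
  have hc : covers g N W set0 set0.
    split; rewrite ?sub0set // => x w xN wW gxw; move/negP: hN; case.
    by apply/exists_inP; exists x => //; apply/exists_inP; exists w.
  by have := cover _ _ hc; rewrite cards0; case=> // -[].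
have [D3|D4] := leqP q.-2 D.
  have eD : D = q.-2 by clear -D3 D2; lia.
  pose P x1 w1 x2 w2 := [&& x1 \in N, x2 \in N, w1 \in W & w2 \in W] &&
    [&& x1 != x2, w1 != w2, g x1 w1 & g x2 w2].
  case: (boolP [exists x1, exists w1, exists x2, exists w2, P x1 w1 x2 w2]).
    case/existsP=> x1 /existsP[w1 /existsP[x2 /existsP[w2]]].
    case/andP=> /and4P[x1N x2N w1W w2W] /and4P[nx nw g1 g2].
    have := cnt_center_q2 gC g0 vU vmax q9 Ufree eD x1N x2N w1W w2W nx nw g1 g2.
    rewrite -/N -/W -/D => h1.
    have h3 := add_le D.+1 #|W| (ltac:(clear -eD q9; lia)) (esym cU).
    apply: leq_trans h3; apply: leq_trans h1 _; rewrite -addnA leq_add //.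
    (* The inequality [6 * D + 8 <= D.+1 * D] holds from [D = 7] on and fails at 6; [D = q - 2] and
       [9 <= q] are just enough. *)
    have [d ->] : exists d, D = 7 + d by exists (D - 7); clear -eD q9; lia.
    by rewrite /=; clear; lia.
  move=> hN; have [|XA [XB [hc hs]]] := @konig1 _ g N W.
    move=> x1 y1 x2 y2 x1N x2N y1W y2W nx ny g1 g2; move/negP: hN; case.
    apply/existsP; exists x1; apply/existsP; exists y1; apply/existsP; exists x2.
    by apply/existsP; exists y2; apply/andP; split; apply/and4P.
  have hs' : #|XA| + #|XB| <= q.-1 - D by clear -hs eD q9; lia.
  by have [//|[e1 e2]] := cover XA XB hc hs' Dq; move: hs; rewrite e1 e2.
have eD : D = q - 3 by clear -D4 Dhi; lia.
have [|XA [XB [hc hs]]] := @konig2 _ g N W.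
  move=> x1 y1 x2 y2 x3 y3 x1N x2N x3N y1W y2W y3W ux uy g1 g2 g3.
  have hu : uniq ([:: x1; x2; x3] ++ [:: y1; y2; y3]).
    rewrite cat_uniq ux uy andbT -all_predC; apply/allP => y yY; apply/negP => yX.
    have xN : y \in N by move: yX; rewrite !inE => /or3P[] /eqP->; move: x1N x2N x3N; rewrite !inE.
    suff yW : y \in W by rewrite WN in xN.
    by move: yY; rewrite inE in_cons mem_seq1 => /or3P[] /eqP->.
  have sW := subsetP sWv.
  have := no_spider g0 vU Ufree x1N x2N x3N (sW _ y1W) (sW _ y2W) (sW _ y3W) hu g1 g2 g3.
  by rewrite !WN // -/N -/D; clear -eD q9; lia.
have hs' : #|XA| + #|XB| <= q.-1 - D by clear -hs eD q9; lia.
have [//|[e1 e2]] := cover XA XB hc hs' Dq.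
have := cover_cut gC g0 vU vmax hc; rewrite -/N -/W -/D e1.
have -> : XB = set0 by apply/eqP; rewrite -cards_eq0 e2.
rewrite cards0 setD0 eD => h1.
have eU : #|U| = q - 2 + #|W| by clear -cU eD q9; lia.
(* The exceptional cover: the cost is two ordered pairs, that is one edge, more than a clique on the
   [q - 2] removed vertices. *)
have h2 : ((q - 3).+1 - 2) * (q - 3 - 2) + 2 * (2 + 0) * (q - 3) = (q - 2) * (q - 3) + 2.
  have [d ->] : exists d, q = 5 + d by exists (q - 5); clear -q9; lia.
  have -> : (5 + d - 3).+1 - 2 = d.+1 by clear; lia.
  have -> : 5 + d - 3 - 2 = d by clear; lia.
  have -> : 5 + d - 3 = d.+2 by clear; lia.
  have -> : 5 + d - 2 = d.+3 by clear; lia.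
  by clear; lia.
have [W0|W0] := eqVneq (#|W| %% q) 0; last first.
  have := turan_bound_add_strict q9 W0; rewrite -eU; clear -h1 h2 IH0; lia.
have Wpos : 0 < #|W| by clear -eU qU; lia.
have := turan_bound_add_dvd q9 W0 Wpos; rewrite -eU.
have h3 : cnt g W W <= #|W| * (q - 3).
  apply: cnt_leM => x xW; rewrite -eD; apply: leq_trans (vmax x (subsetP WU x xW)).
  exact: cntS.
rewrite mulnC in h3; clear -h1 h2 h3; lia.
Qed.

Theorem cnt_spider_free U : spider_free g q U -> cnt g U U <= turan_bound q #|U|.
Proof.
have [m] := ubnP #|U|; elim: m U => // m IH U Um Ufree.
have [Uq|qU] := leqP #|U| q.
  have := turan_bound_add_le 0 q9 Uq; rewrite addn0; have := cnt_complete U g0; clear; lia.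
have [v0 v0U] : exists v0, v0 \in U by apply/card_gt0P; clear -qU; lia.
case: (arg_maxnP (fun x => cnt g [set x] U) v0U) => v vU vmax.
apply: (cnt_spider_free_step vU) => // U' sU' lt; apply: IH; last exact: spider_freeS sU' Ufree.
clear -lt Um; lia.
Qed.

End UpperBound.

(** * From set systems to relations *)

Section Edges.
Variables (p : nat) (E : {set {set 'I_p}}).
Hypothesis sE : simple_graph E.

Definition adj : rel 'I_p := fun x y => [set x; y] \in E.

Lemma adjC : symmetric adj.
Proof. by move=> x y; rewrite /adj setUC. Qed.

Lemma adj0 : irreflexive adj.
Proof.
move=> x; apply/negP => /(forall_inP sE); by rewrite setUid cards1.
Qed.

(** Double counting of incidences: every edge has two ends, and the edges at [x] correspond to its
    neighbours through [y] mapped to [[set x; y]]. *)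
Lemma cnt_adj : cnt adj setT setT = 2 * #|E|.
Proof.
have -> : 2 * #|E| = \sum_(e in E) \sum_(x : 'I_p) (x \in e).
  rewrite mulnC -sum_nat_const; apply: eq_bigr => e /(forall_inP sE)/eqP <-.
  by rewrite -sum1_card big_mkcond; apply: eq_bigr => x _; case: (x \in e).
rewrite exchange_big /cnt big_mkcond; apply: eq_bigr => x _; rewrite inE.
transitivity #|[set y | adj x y]|.
  rewrite -sum1_card big_mkcond [RHS]big_mkcond.
  by apply: eq_bigr => y _; rewrite !inE; case: (adj x y).
have inj : {in [set y | adj x y] &, injective (fun y => [set x; y])}.
  move=> y z; rewrite !inE => hy hz e.
  have : y \in [set x; z] by rewrite -e set22.
  by case/set2P => // exy; move: hy; rewrite exy adj0.
rewrite -(card_in_imset inj) -sum1_card big_mkcond [RHS]big_mkcond.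
apply: eq_bigr => e _; suff -> : (e \in [set [set x; y] | y in [set y | adj x y]]) = (e \in E) && (x \in e).
  by case: (e \in E); case: (x \in e).
apply/imsetP/andP => [[y]|[eE xe]].
  by rewrite inE => hy ->; rewrite set21.
have : #|e :\ x| = 1 by have := forall_inP sE e eE; rewrite (cardsD1 x e) xe => /eqP[].
case/eqP/cards1P=> y ey; exists y; last by rewrite -ey setD1K.
by rewrite inE /adj -ey setD1K.
Qed.

End Edges.

Definition edges_of p (h : rel 'I_p) : {set {set 'I_p}} :=
  [set e | [exists x, exists y, h x y && (e == [set x; y])]].

Lemma edges_of_simple p (h : rel 'I_p) : irreflexive h -> simple_graph (edges_of h).
Proof.
move=> h0; apply/forall_inP => e; rewrite inE => /existsP[x /existsP[y /andP[hxy /eqP->]]].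
by rewrite cards2; case: (x =P y) hxy => // ->; rewrite h0.
Qed.

Lemma adj_edges_of p (h : rel 'I_p) : symmetric h -> irreflexive h -> adj (edges_of h) =2 h.
Proof.
move=> hC h0 x y; rewrite /adj inE; apply/existsP/idP => [[a /existsP[b /andP[hab /eqP e]]]|hxy].
  have nab : a != b by apply: contraTneq hab => ->; rewrite h0.
  have nxy : x != y by have := cards2 x y; rewrite e cards2 nab; case: (x =P y).
  have : x \in [set a; b] by rewrite -e set21.
  have : y \in [set a; b] by rewrite -e set22.
  by case/set2P=> ey /set2P[] ex; move: nxy; rewrite ex ey ?eqxx // hC.
by exists x; apply/existsP; exists y; rewrite hxy eqxx.
Qed.

(** * Connectedness of the tree, and its embedding around a vertex *)

Section Spider.
Variables (n : nat) (n10 : 10 <= n).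

(** Connectedness in colouring form, which later confines an embedded tree to one side of a disjoint
    union. *)
Lemma T3_connected (X : eqType) (c : 'I_n -> X) :
  (forall i j, T3 i j -> c i = c j) -> forall i j, c i = c j.
Proof.
move=> hc; have h0 : 0 < n by lia.
suff h i : c i = c (Ordinal h0) by move=> i j; rewrite !h.
have step (j k : 'I_n) : c j = c (Ordinal h0) -> T3 j k -> c k = c (Ordinal h0).
  by move=> <- hjk; rewrite (hc _ _ hjk).
have near (j : 'I_n) : 1 <= j <= n - 4 -> c j = c (Ordinal h0).
  by move=> hj; apply: (step (Ordinal h0)) => //; rewrite /T3 /T3_dir /= hj.
have [i0|i0] := posnP i; first by congr c; apply: val_inj.
have [i1|i1] := leqP i (n - 4); first by apply: near; rewrite i0.
(* The remaining vertices [n - 3], [n - 2], [n - 1] hang from 1, 2, 3, that is from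
   [i - (n - 4)]. *)
have hi := ltn_ord i; have hk : i - (n - 4) < n by lia.
apply: (step (Ordinal hk)); first by apply: near => /=; lia.
have [ei|[ei|ei]] : i = n - 3 :> nat \/ i = n - 2 :> nat \/ i = n - 1 :> nat.
- by clear -n10 i1 hi; lia.
- by rewrite /T3 /T3_dir /= (_ : i - (n - 4) = 1) ?ei ?eqxx //; clear -n10 ei; lia.
- by rewrite /T3 /T3_dir /= (_ : i - (n - 4) = 2) ?ei ?eqxx //; clear -n10 ei; lia.
by rewrite /T3 /T3_dir /= (_ : i - (n - 4) = 3) ?ei ?eqxx //; clear -n10 ei; lia.
Qed.

Lemma spider_contains p (E : {set {set 'I_p}}) : simple_graph E ->
  ~~ contains_sub E (@T3 n) -> spider_free (adj E) n.-1 setT.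
Proof.
move=> sE hE v x1 x2 x3 y1 y2 y3 _ hu gx1 gx2 gx3 g1 g2 g3.
rewrite ltnNge; apply: contra hE => hS.
set S := [set x1; x2; x3; y1; y2; y3] in hS.
set N := [set z in setT | adj E v z] in hS.
pose l := take (n - 7) (enum (N :\: S)).
have sl : size l = n - 7 by rewrite size_takel // -cardE; clear -hS n10; lia.
have lN z : z \in l -> z \in N :\: S by move/mem_take; rewrite mem_enum.
(* The vertices in the order of the tree's labels: centre 0, branching neighbours 1 to 3, the
   [n - 7] plain leaves from 4 to [n - 4], then the three outer leaves. *)
pose s := [:: v; x1; x2; x3] ++ l ++ [:: y1; y2; y3].
have ss : size s = n by rewrite /s !size_cat sl /=; clear -n10; lia.
have us : uniq s.
  rewrite (perm_uniq (_ : perm_eq s ([:: v; x1; x2; x3; y1; y2; y3] ++ l))); last first.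
    by rewrite /s (perm_catl [:: v; x1; x2; x3] (_ : perm_eq _ ([:: y1; y2; y3] ++ l))) // perm_catC.
  rewrite cat_uniq hu take_uniq ?enum_uniq // andbT -all_predC; apply/allP => z /lN.
  rewrite in_setD => /andP[zS zN]; apply/negP => /=; rewrite in_cons => /predU1P[ez|zs].
    by move: zN; rewrite ez !inE adj0.
  by move/negP: zS; apply; move: zs; rewrite !inE -!orbA.
pose f := [ffun i : 'I_n => nth v s i].
apply/existsP; exists f; apply/andP; split.
  apply/injectiveP => i j; rewrite !ffunE => /eqP; rewrite nth_uniq ?ss ?ltn_ord // => /eqP e.
  exact: val_inj.
have nl j : 4 <= j -> nth v s j = nth v (l ++ [:: y1; y2; y3]) (j - 4).
  by move=> j4; rewrite /s nth_cat /= ltnNge j4.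
have ny k : nth v s (n - 3 + k) = nth v [:: y1; y2; y3] k.
  rewrite nl; last by clear -n10; lia.
  rewrite nth_cat sl ltnNge (_ : n - 7 <= n - 3 + k - 4); last by clear -n10; lia.
  by congr nth; clear -n10; lia.
have ny1 : nth v s (n - 3) = y1 by rewrite -[n - 3]addn0 ny.
have ny2 : nth v s (n - 2) = y2.
  by rewrite (_ : n - 2 = n - 3 + 1) ?ny; last by clear -n10; lia.
have ny3 : nth v s (n - 1) = y3.
  by rewrite (_ : n - 1 = n - 3 + 2) ?ny; last by clear -n10; lia.
have dir (i j : 'I_n) : T3_dir i j -> adj E (f i) (f j).
  rewrite !ffunE; case/or4P=> /andP[/eqP-> hj].
  - have [j4|j4] := leqP 4 j; last first.
      by case: (j : nat) hj j4 => [|[|[|[|]]]].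
    rewrite [nth v s 0]/= nl // nth_cat sl (_ : j - 4 < n - 7); last by clear -n10 hj j4; lia.
    have := lN (nth v l (j - 4)) _; rewrite mem_nth ?sl; last by clear -n10 hj j4; lia.
    by move=> /(_ isT); rewrite !inE => /andP[].
  - by rewrite (eqP hj) ny1.
  - by rewrite (eqP hj) ny2.
  by rewrite (eqP hj) ny3.
apply/forallP => i; apply/forallP => j; apply/implyP => /orP[/dir//|/dir].
by rewrite -/(adj E _ _) adjC.
Qed.

Lemma ex_upper p : 2 * ex p (@T3 n) <= turan_bound n.-1 p.
Proof.
rewrite /ex; elim/big_ind: _ => [|a b|E /andP[sE fE]]; first by [].
  by move=> *; lia.
rewrite -cnt_adj //; have := @cnt_spider_free _ (adj E) (adjC E) (adj0 sE) n.-1 _ setT.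
by rewrite cardsT card_ord; apply; [lia|apply: spider_contains].
Qed.

End Spider.

(** * Extremal graphs *)

Section LowerBound.
Variables (n : nat) (n10 : 10 <= n).
Implicit Types (h : rel nat).

(** Host graphs are relations on [nat] cut off at [p], so that adjoining a block shifts indices
    without casts between ordinal types. *)
Definition T3_free_below p h := forall f : 'I_n -> nat, injective f ->
  (forall i, f i < p) -> ~ (forall i j, T3 i j -> h (f i) (f j)).

Definition pairs h p := \sum_(i < p) \sum_(j < p) h i j.

(** As [pairs] counts ordered pairs, [e] is twice a number of edges. *)
Definition attained p e := exists h,
  [/\ symmetric h, irreflexive h, pairs h p = e & T3_free_below p h].

Lemma attained_ex p e : attained p e -> e <= 2 * ex p (@T3 n).
Proof.
case=> h [hC h0 <- hF]; pose g : rel 'I_p := fun i j => h i j.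
have gC : symmetric g by move=> i j; apply: hC.
have g0 : irreflexive g by move=> i; apply: h0.
have sE := edges_of_simple g0.
have -> : pairs h p = 2 * #|edges_of g|.
  rewrite -(cnt_adj sE) /cnt big_mkcond; apply: eq_bigr => i _; rewrite inE.
  by rewrite [RHS]big_mkcond; apply: eq_bigr => j _; rewrite inE adj_edges_of.
rewrite leq_mul2l /=; apply: leq_bigmax_cond; rewrite sE.
apply/existsP => -[f /andP[/injectiveP fI /forallP fE]].
apply: (hF (fun i => f i)) => [i j /val_inj/fI//|i|i j hij]; first exact: ltn_ord.
have := adj_edges_of gC g0 (f i) (f j); rewrite /adj /g => <-.
by move/forallP: (fE i) => /(_ j)/implyP; apply.
Qed.

Lemma inj_leq (f : 'I_n -> nat) a m : injective f ->
  (forall i, a <= f i < a + m) -> n <= m.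
Proof.
move=> fI fb; have := @uniq_leq_size _ (codom f) (iota a m).
rewrite size_codom card_ord size_iota; apply; first by rewrite map_inj_uniq ?enum_uniq.
by move=> x /codomP[i ->]; rewrite mem_iota.
Qed.

Lemma pairs_complete p : pairs (fun i j => i != j) p = p * p.-1.
Proof.
transitivity (\sum_(i < p) p.-1); last by rewrite sum_nat_const card_ord.
apply: eq_bigr => i _; have := cardC1 i; rewrite card_ord => <-.
rewrite -sum1_card [RHS]big_mkcond; apply: eq_bigr => j _.
by rewrite !inE -val_eqE /= eq_sym; case: (_ == _).
Qed.

Lemma attained_complete p : p < n -> attained p (p * p.-1).
Proof.
move=> pn; exists (fun i j => i != j); split.
- by move=> i j; rewrite eq_sym.
- by move=> i; rewrite eqxx.
- exact: pairs_complete.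
by move=> f fI fp _; have := @inj_leq f 0 p fI fp; lia.
Qed.

(** Adjoins a disjoint complete graph on [n.-1] vertices. The tree is connected, so a copy lies in
    the old graph or in the block, which is too small. *)
Lemma attained_add p e : attained p e -> attained (p + n.-1) (e + n.-1 * n.-1.-1).
Proof.
case=> h [hC h0 he hF].
pose h' i j := if (i < p) && (j < p) then h i j else [&& p <= i, p <= j & i != j].
exists h'; split.
- by move=> i j; rewrite /h' andbC hC andbCA (eq_sym j).
- by move=> i; rewrite /h' h0 eqxx !andbF if_same.
- rewrite -he -pairs_complete /pairs big_split_ord /=; congr (_ + _).
    apply: eq_bigr => i _; rewrite big_split_ord /= [X in _ + X]big1 ?addn0 => [|j _].
      by apply: eq_bigr => j _; rewrite /h' !ltn_ord.
    by rewrite /h' ltn_ord ltnNge leq_addr /= leqNgt ltn_ord.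
  apply: eq_bigr => i _; rewrite big_split_ord /= [X in X + _]big1 ?add0n => [|j _].
    by apply: eq_bigr => j _; rewrite /h' ltnNge !leq_addr eqn_add2l.
  by rewrite /h' ltnNge leq_addr /= (leqNgt p j) ltn_ord.
move=> f fI fp hf; have i0 : 'I_n by apply: (@Ordinal n 0); lia.
have hcon i : (f i < p) = (f i0 < p).
  apply: (T3_connected n10 (c := fun k => f k < p)) => {}i j /hf; rewrite /h' !(leqNgt p).
  by case: (f i < p); case: (f j < p).
have [lt|ge] := boolP (f i0 < p).
  apply: (hF f) => // i; first by rewrite hcon.
  by move=> j /hf; rewrite /h' !hcon lt.
have : n <= n.-1; last lia.
by apply: (@inj_leq f p) => // i; rewrite fp andbT leqNgt hcon.
Qed.

(** The centre of the tree already needs [n - 4] neighbours. *)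
Lemma attained_degree p h : symmetric h -> irreflexive h ->
  (forall i : 'I_p, \sum_(j < p) h i j <= n - 5) -> attained p (pairs h p).
Proof.
move=> hC h0 hd; exists h; split=> // f fI fp hf.
have n0 : 0 < n by lia.
pose v := f (Ordinal n0).
have hu (j : 'I_(n - 4)) : j.+1 < n by have := ltn_ord j; lia.
pose u j : 'I_p := Ordinal (fp (Ordinal (hu j))).
have uI : injective u by move=> j k [] /fI[] /val_inj.
have : n - 4 <= \sum_(j < p) h v j; last by have := hd (Ordinal (fp (Ordinal n0))); rewrite -/v /=; lia.
have -> : \sum_(j < p) h v j = #|[set j : 'I_p | h v j]|.
  by rewrite -sum1_card [RHS]big_mkcond; apply: eq_bigr => j _; rewrite inE; case: (h v j).
rewrite -{1}(card_ord (n - 4)) -(card_codom uI); apply: subset_leq_card.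
apply/subsetP => _ /codomP[j ->]; rewrite inE; apply: hf.
by rewrite /T3 /T3_dir /=; have := ltn_ord j; lia.
Qed.

End LowerBound.

(** * Nearly regular circulant graphs *)

Definition dist i j := (i - j) + (j - i).

(** Adjacency at cyclic distance at most [a] on [m] points; the second alternative is the
    wrap-around. *)
Definition circulant m a i j := (0 < dist i j <= a) || (m - a <= dist i j).

(* A [2 a]-regular circulant graph plus, when [c], the matching [i -- i + m./2]
   for [i < m./2], which misses the last vertex if [m] is odd. *)
Definition near_circulant m a (c : bool) i j :=
  circulant m a i j || [&& c, dist i j == m./2 & minn i j < m./2].

(** The two new neighbours are [i + a.+1] and [i - a.+1] modulo [m], distinct because
    [2 * a.+1 < m]. *)
Lemma circulant_step m a i j : 2 * a.+1 < m -> i < m -> j < m ->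
  circulant m a.+1 i j = circulant m a i j
    + ((j == if i + a.+1 < m then i + a.+1 else i + a.+1 - m)
    + (j == if a.+1 <= i then i - a.+1 else i + m - a.+1)) :> nat.
Proof.
rewrite /circulant /dist => h1 h2 h3.
case: (ltnP (i + a.+1) m) => h4; case: (leqP a.+1 i) => h5; (case: eqP => h6; case: eqP => h7); lia.
Qed.

Lemma sum_eq m k : k < m -> \sum_(j < m) (j == k :> nat) = 1.
Proof.
move=> km; rewrite (bigD1 (Ordinal km)) //= eqxx big1 // => j; rewrite -val_eqE /=.
by move/negbTE->.
Qed.

Lemma circulant_row m a i : 2 * a < m -> i < m -> \sum_(j < m) circulant m a i j = 2 * a.
Proof.
move=> + im; elim: a => [|a IH] am.
  by rewrite big1 // => j _; rewrite /circulant /dist; have := ltn_ord j; lia.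
under eq_bigr => j _ do rewrite circulant_step //.
rewrite big_split big_split /= IH; last lia.
by rewrite !sum_eq; [lia| |]; case: ifP; lia.
Qed.

(** The assumption [2 * a + 3 < m] puts [m./2] strictly between [a] and [m - a], so matching edges
    are new to the circulant graph. *)
Lemma near_circulant_split m a (c : bool) i j : 2 * a + 3 < m -> i < m -> j < m ->
  near_circulant m a c i j = circulant m a i j
    + (c && (i < 2 * m./2)) * (j == if i < m./2 then i + m./2 else i - m./2) :> nat.
Proof.
rewrite /near_circulant /circulant /dist /minn => h1 h2 h3; have := odd_double_half m.
move: (m./2) (odd m : nat) (leq_b1 (odd m)) => h b b1 hb.
case: c; rewrite ?andbF ?addn0 ?orbF //=.
case: (ltnP i j) => h4; case: (ltnP i h) => h5; case: eqP => h6; case: eqP => h7; lia.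
Qed.

Lemma near_circulant_row m a (c : bool) i : 2 * a + 3 < m -> i < m ->
  \sum_(j < m) near_circulant m a c i j = 2 * a + (c && (i < 2 * m./2)).
Proof.
move=> am im; under eq_bigr => j _ do rewrite near_circulant_split //.
rewrite big_split circulant_row //; last lia.
rewrite -big_distrr /= sum_eq ?muln1 //.
by case: ifP; lia.
Qed.

(** The vertex missed by the matching for odd [m] is exactly what the rounded half accounts for. *)
Lemma near_circulant_pairs m a (c : bool) : 2 * a + 3 < m ->
  pairs (near_circulant m a c) m = 2 * ((2 * a + c) * m)./2.
Proof.
move=> am; rewrite /pairs; under eq_bigr => i _ do rewrite near_circulant_row //.
rewrite big_split sum_nat_const card_ord /=.
have -> : \sum_(i < m) (c && (i < 2 * m./2)) = c * (2 * m./2).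
  case: c => /=; last by rewrite big1.
  have hm : 2 * m./2 <= m by lia.
  rewrite mul1n -[RHS]muln1 -{2}(card_ord (2 * m./2)) -sum_nat_const.
  by rewrite (big_ord_widen _ (fun=> 1) hm) [RHS]big_mkcond.
case: c; lia.
Qed.

Lemma attained_regular n m : 10 <= n -> n.-1 <= m -> attained n m (2 * ((n - 5) * m)./2).
Proof.
move=> n10 nm; pose a := (n - 5)./2; pose c := odd (n - 5).
have e5 : n - 5 = 2 * a + c by rewrite /a /c; lia.
have am : 2 * a + 3 < m by lia.
rewrite {1}e5 -near_circulant_pairs //; apply: attained_degree => //.
- by move=> i j; rewrite /near_circulant /circulant /dist minnC addnC.
- by move=> i; rewrite /near_circulant /circulant /dist subnn; case: c am {e5}; lia.
by move=> i; rewrite near_circulant_row // e5 leq_add2l; case: (c) => //=; case: (_ < _).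
Qed.

Lemma attained_blocks n r k e : 10 <= n -> attained n r e ->
  attained n (k * n.-1 + r) (k * (n.-1 * n.-1.-1) + e).
Proof.
move=> n10 h; elim: k => [//|k IH]; have := attained_add n10 IH.
have -> : k * n.-1 + r + n.-1 = k.+1 * n.-1 + r by rewrite mulSn; lia.
by rewrite mulSn [_ + _ * n.-1.-1]addnC addnA.
Qed.

Local Open Scope ring_scope.

Theorem theorem5p1 (p n k r : nat) :
  (10 <= n)%N -> (n <= p)%N -> (0 < k)%N ->
  p = (k * (n - 1) + r)%N -> (r <= n - 2)%N ->
  ((ex p (@T3 n))%:Z =
     (((n%:Z - 2) * p%:Z - r%:Z * (n%:Z - 1 - r%:Z)) %/ 2)%Z
     + Num.max 0 ((r%:Z * (n%:Z - 4 - r%:Z) - 3 * (n%:Z - 1)) %/ 2)%Z).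
Proof.
move=> n10 np k0 ep rn; set e := ex p (@T3 n).
have rq : (r < n.-1)%N by lia.
have ep' : p = (k * n.-1 + r)%N by rewrite ep subn1.
have up : (2 * e <= turan_bound n.-1 p)%N by apply: ex_upper.
have lo1 : (k * (n.-1 * n.-1.-1) + r * r.-1 <= 2 * e)%N.
  rewrite /e ep'; apply: attained_ex; apply: attained_blocks => //.
  by apply: attained_complete; lia.
(* One block is given up and merged with the [r] leftover vertices into a nearly [(n - 5)]-regular
   graph. *)
have lo2 : (k.-1 * (n.-1 * n.-1.-1) + 2 * ((n - 5) * (n.-1 + r))./2 <= 2 * e)%N.
  have ep2 : p = (k.-1 * n.-1 + (n.-1 + r))%N.
    by rewrite ep' -{1}(prednK k0) mulSn; lia.
  rewrite /e ep2; apply: attained_ex; apply: attained_blocks => //.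
  by apply: attained_regular; lia.
have [q eq_n] : exists q, n = q.+1 by exists n.-1; lia.
have [k' ek] : exists k', k = k'.+1 by exists k.-1; lia.
move: up lo1 lo2; rewrite ep' eq_n ek turan_boundE; last by rewrite eq_n in rq.
rewrite /= subSS; move: (e) => m.
(* Clique counts are even, so the first quotient of the statement is exact and rounding affects only
   [X], the degree sum [(q - 4) * (q + r)]. *)
have /dvdnP[s es] : (2 %| q * q.-1)%N.
  by case: (q) => [|w]; rewrite // dvdn2 oddM /=; case: (odd w).
have /dvdnP[u eu] : (2 %| r * r.-1)%N.
  by case: (r) => [|w]; rewrite // dvdn2 oddM /=; case: (odd w).
have h1 := sqr_pred q; have h2 := sqr_pred r.
have h3 := @mul_sub4 q (q + r) (ltac:(lia)).
rewrite es eu in h1 h2 *.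
move: ((q - 4) * (q + r))%N h3 => X h3 up lo1 lo2.
have -> : (q.+1%:Z - 2) * (k'.+1 * q + r)%N%:Z - r%:Z * (q.+1%:Z - 1 - r%:Z) =
    2 * (k' * s + s + u)%N%:Z by clear -h1 h2; lia.
(* The second numerator is the gain in ordered pairs from replacing a full clique and a clique on
   [r] vertices by the nearly regular graph; the maximum with 0 selects the better construction. *)
have -> : r%:Z * (q.+1%:Z - 4 - r%:Z) - 3 * (q.+1%:Z - 1) =
    X%:Z - 2 * (s + u)%N%:Z by clear -h1 h2 h3; lia.
rewrite (mulSn k') in up lo1; rewrite !mulnA in up lo1 lo2.
clear -up lo1 lo2; move: (k' * s)%N up lo1 lo2 => B up lo1 lo2; lia.
Qed.
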